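(* Let $\boldsymbol{u}\colon\mathbb{N}\to\mathbb{C}$ be a bounded multiplicative function such that $\frac1{b_K}\sum_{k<K}\bigl|\sum_{b_k\le n<b_{k+1}}\boldsymbol{u}(n)\bigr|\to0$ as $K\to\infty$ for every increasing sequence of integers $0=b_0<b_1<\cdots$ with $b_{k+1}-b_k\to\infty$. Suppose that $(Y,S)$ is a uniquely ergodic topological dynamical system, with unique invariant measure $\nu$, which satisfies the strong MOMO property relatively to $\boldsymbol{u}$. Let $G$ be a compact (metric) Abelian group and let $\varphi\colon Y\to G$ be continuous with $\varphi=\psi\circ S-\psi$ ($\nu$-almost everywhere), where $\psi\colon Y\to G$ is measurable. Then $(Y\times G,S_\varphi)$, where $S_\varphi(y,g)=(Sy,\varphi(y)+g)$, satisfies the Sarnak property relatively to $\boldsymbol{u}$.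
   Context: $\boldsymbol{u}$ is multiplicative if $\boldsymbol{u}(1)=1$ and $\boldsymbol{u}(mn)=\boldsymbol{u}(m)\boldsymbol{u}(n)$ for coprime $m,n$; put $\boldsymbol{u}(0):=0$ in sums containing $n=0$. A topological dynamical system $(X,T)$ is a compact metric space with a continuous map $T\colon X\to X$; it is uniquely ergodic if it has exactly one invariant Borel probability measure. Sarnak property of $(X,T)$ relatively to $\boldsymbol{u}$: for every $x\in X$ and $f\in C(X)$, $\frac1N\sum_{n<N}f(T^nx)\boldsymbol{u}(n)\to0$ as $N\to\infty$. Strong MOMO property of $(X,T)$ relatively to $\boldsymbol{u}$: for every increasing sequence of integers $0=b_0<b_1<b_2<\cdots$ with $b_{k+1}-b_k\to\infty$, every sequence $(x_k)$ in $X$ and every $f\in C(X)$, $$\frac1{b_K}\sum_{k<K}\Bigl|\sum_{b_k\le n<b_{k+1}}f(T^{n-b_k}x_k)\boldsymbol{u}(n)\Bigr|\to0\quad (K\to\infty).$$ *)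

(* Defs.v *)
From HB Require Import structures.
From mathcomp Require Import all_boot all_order all_algebra.
From mathcomp Require Import all_classical all_reals all_analysis.
From mathcomp Require Import complex.

Set Implicit Arguments.
Unset Strict Implicit.
Unset Printing Implicit Defensive.

Import Order.TTheory GRing.Theory Num.Theory numFieldNormedType.Exports.

Local Open Scope classical_set_scope.
Local Open Scope ring_scope.
Local Open Scope complex_scope.

(* The topology of R[i] given by the complex modulus. *)
HB.instance Definition _ (R : rcfType) := NormedModule.copy R[i] R[i]^o.

(* Measurable types are pointed in the library, so the phase space carrying the
   invariant measure is taken pointed; a space carrying a probability measure is
   nonempty, hence nothing is lost. *)
#[short(type="pointedMetricType")]
HB.structure Definition PointedMetric (K : numDomainType) :=
  {M of Metric K M & Pointed M}.

(* The library hierarchy has no join of metric spaces and topological groups;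
   being a metric group is expressed by a distance inducing the topology. *)
Definition metrizable (R : realType) (T : topologicalType) : Prop :=
  exists d : T -> T -> R,
    [/\ forall x y, (d x y = 0) <-> (x = y),
        forall x y, d x y = d y x,
        forall x y z, d x z <= d x y + d y z &
        forall x, nbhs x =
          filter_from [set e : R | 0 < e] (fun e => [set y | d x y < e])].

Definition borel (T : topologicalType) := g_sigma_algebraType (@open T).

Definition topological_dynamical_system (X : topologicalType) (T : X -> X) :
  Prop := compact [set: X] /\ continuous T.

Section arithmetic.
Variable R : realType.
Implicit Types u : nat -> R[i].

Definition bounded_sequence u : Prop :=
  exists M : R, forall n, `|u n| <= M%:C.

(* u is a function on the positive integers; being defined on nat, it is extended
   by u 0 = 0, which is the convention for sums containing the index 0. *)
Definition multiplicative_function u : Prop :=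
  [/\ u 0%N = 0, u 1%N = 1 &
      forall m n : nat, (0 < m)%N -> (0 < n)%N -> coprime m n ->
        u (m * n)%N = u m * u n].

Definition block_sequence (b : nat -> nat) : Prop :=
  [/\ b 0%N = 0%N, forall k, (b k < b k.+1)%N &
      (b k.+1 - b k)%N @[k --> \oo] --> \oo].

Definition short_interval_aperiodic u : Prop :=
  forall b : nat -> nat, block_sequence b ->
    ((b K)%:R^-1 * \sum_(k < K) `|\sum_(b k <= n < b k.+1) u n|)
      @[K --> \oo] --> (0 : R[i]).

Definition sarnak_property (X : topologicalType) (T : X -> X) u : Prop :=
  forall (x : X) (f : X -> R[i]), continuous f ->
    (N%:R^-1 * \sum_(n < N) f (iter n T x) * u n)
      @[N --> \oo] --> (0 : R[i]).

Definition strong_MOMO (X : topologicalType) (T : X -> X) u : Prop :=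
  forall (b : nat -> nat) (x : nat -> X) (f : X -> R[i]),
    block_sequence b -> continuous f ->
    ((b K)%:R^-1 * \sum_(k < K)
        `|\sum_(b k <= n < b k.+1) f (iter (n - b k) T (x k)) * u n|)
      @[K --> \oo] --> (0 : R[i]).

End arithmetic.

Section ergodic.
Variables (R : realType) (Y : pointedMetricType R).

Definition invariant_measure (S : Y -> Y) (mu : probability (borel Y) R) :
  Prop := forall A : set (borel Y), measurable A -> mu (S @^-1` A) = mu A.

(* A library measure is a function on all sets, whose values off the
   sigma-algebra are junk; uniqueness is therefore equality on Borel sets. *)
Definition uniquely_ergodic (S : Y -> Y) (nu : probability (borel Y) R) :
  Prop := invariant_measure S nu /\
    forall mu : probability (borel Y) R, invariant_measure S mu ->
      forall A : set (borel Y), measurable A -> mu A = nu A.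

End ergodic.

(* The unfolding of measurable_fun for the two Borel sigma-algebras; it avoids
   requiring canonical points in X and Y. *)
Definition borel_measurable (X Y : topologicalType) (f : X -> Y) : Prop :=
  forall B : set Y, <<s @open Y >> B -> <<s @open X >> (f @^-1` B).

Definition skew_product (Y : Type) (G : zmodType) (S : Y -> Y) (phi : Y -> G)
  (p : Y * G) : Y * G := (S p.1, phi p.1 + p.2).

(* Main.v *)
(* No characters of [G] are needed: for an observable [f] on [Y * G], the orbit of
   [(z, g)] satisfies [f (T^n (z, g)) = f (S^n z, psi (S^n z) + (g - psi z))] for
   almost every [z], so along the orbit of [z] it is the sequence of values of one
   of the functions [y |-> f (y, psi y + c)]. By compactness of [G] finitely many
   [c] suffice up to a small error, and by Lusin's theorem these functions agree,
   up to a set of small measure, with continuous functions [theta_i] on [Y].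
   Hence, for every fixed length [L], outside a closed set of small measure the
   window of length [L] starting at [z] is close on average to the window of some
   [theta_i], uniformly in [g]. Unique ergodicity bounds the frequency with which
   any orbit visits this closed set, and strong MOMO for the [theta_i] (with
   [x_k = S^(b_k) y]) bounds the sums over the remaining windows.

   The bound on visit frequencies is obtained without the Riesz representation
   theorem: frequencies along an ultrafilter form an invariant finitely additive
   measure on all subsets, whose inner content on open sets generates, through an
   outer measure, an invariant Borel measure. *)
Require Import Defs.
From HB Require Import structures.
From mathcomp Require Import all_boot all_order all_algebra.
From mathcomp Require Import all_classical all_reals all_analysis.
From mathcomp Require Import complex.
From mathcomp Require Import measurable_realfun.
From mathcomp Require Import zify ring lra.
Import Order.TTheory GRing.Theory Num.Theory numFieldNormedType.Exports.
Local Open Scope classical_set_scope.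
Local Open Scope ring_scope.
Local Open Scope complex_scope.

Set Implicit Arguments.
Unset Strict Implicit.

(** * Averages over windows of fixed length *)

Section window_averages.
Variable R : realType.

(** The first [k0] windows of every residue class cost at most [D] in total, a number independent of
    [N]. Once [N] is large this is at most [e / 2 * N], so dropping them keeps half of the
    excess. *)
Lemma late_windows_cost (c : nat -> nat -> R) (e : R) (L b : nat) :
  (forall s t, 0 <= c s t) -> 0 < e -> (0 < L)%N ->
  (forall N0, exists N r, [/\ (N0 <= N)%N, (r < L)%N &
    e * N%:R < \sum_(k < (N - r) %/ L) c (r + k * L)%N (r + k.+1 * L)%N]) ->
  exists q : nat * nat * nat, let: (N, r, k0) := q in
    [/\ (b + L <= r + k0 * L)%N, (k0 <= (N - r) %/ L)%N, (r <= N)%N &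
    e / 2 * N%:R <
    \sum_(k0 <= k < (N - r) %/ L) c (r + k * L)%N (r + k.+1 * L)%N].
Proof.
(* With [+ 2] the first retained window starts at least [L] after [b], whatever the residue [r]; the
   block bridging this gap is then long enough too. *)
move=> c0 e0 L0 H; pose k0 := (b %/ L + 2)%N.
pose D : R := \sum_(r < L) \sum_(0 <= k < k0) c (r + k * L)%N (r + k.+1 * L)%N.
pose N1 := Num.truncn (D / (e / 2)).
have [N [r [N0N rL big]]] := H (maxn (k0.+1 * L) N1.+1).
have bk0 : (b + L <= r + k0 * L)%N.
  have := ltn_ceil b L0; rewrite /k0 mulSn mulnDl; lia.
have k0N : (k0 <= (N - r) %/ L)%N.
  rewrite leq_divRL//; move: N0N; rewrite geq_max mulSn => /andP[+ _]; lia.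
exists (N, r, k0); split => //.
  by move: N0N; rewrite geq_max mulSn => /andP[+ _]; lia.
have DN : D <= e / 2 * N%:R.
  rewrite mulrC -ler_pdivrMr ?divr_gt0//.
  have /ltW/le_trans : D / (e / 2) < N1.+1%:R.
    by apply: truncnS_gt.
  apply; rewrite ler_nat; move: N0N; rewrite geq_max => /andP[_ //].
rewrite -(big_mkord xpredT (fun k => c (r + k * L)%N (r + k.+1 * L)%N)) in big.
rewrite (@big_cat_nat _ _ _ k0 0)//= in big.
have : \sum_(0 <= k < k0) c (r + k * L)%N (r + k.+1 * L)%N <= D.
  rewrite /D (bigD1 (Ordinal rL))//= lerDl; apply: sumr_ge0 => i _.
  by apply: sumr_ge0.
lra.
Qed.

(* If no window length [L] works, blocks of length [L = 1, 2, 3, ...], each used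
   on a stretch so long that the past is negligible, form a block sequence
   violating the hypothesis. The states of the iteration below are (current
   breakpoint, stage, right end of the current stretch). *)
Lemma block_average_windows (c : nat -> nat -> R) (e : R) :
  (forall s t, 0 <= c s t) -> 0 < e ->
  (forall b, block_sequence b ->
    ((b K)%:R^-1 * \sum_(k < K) c (b k) (b k.+1)) @[K --> \oo] --> (0 : R)) ->
  exists2 L, (0 < L)%N & \forall N \near \oo, forall r, (r < L)%N ->
    \sum_(k < (N - r) %/ L) c (r + k * L)%N (r + k.+1 * L)%N <= e * N%:R.
Proof.
move=> c0 e0 Hb; apply: contrapT => nL.
have bad L : (0 < L)%N -> forall N0, exists N r, [/\ (N0 <= N)%N, (r < L)%N &
    e * N%:R < \sum_(k < (N - r) %/ L) c (r + k * L)%N (r + k.+1 * L)%N].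
  move=> L0 N0; apply: contrapT => H; apply: nL; exists L => //.
  exists N0 => // N /= N0N r rL; rewrite leNgt; apply/negP => lt.
  by apply: H; exists N, r.
have ch (bj : nat * nat) : exists q : nat * nat * nat, let: (N, r, k0) := q in
    let: (b, L) := (bj.1, bj.2.+1) in
    [/\ (b + L <= r + k0 * L)%N, (k0 <= (N - r) %/ L)%N, (r <= N)%N &
    e / 2 * N%:R <
    \sum_(k0 <= k < (N - r) %/ L) c (r + k * L)%N (r + k.+1 * L)%N].
  by apply: late_windows_cost => //; exact: bad.
have {ch bad nL}[g gP] := choice ch.
(* Stage [j] places blocks of length [j.+1] as long as they fit below [N]. The next block then jumps
   to the first late window that [g] provides for length [j.+2]. *)
pose step (q : nat * nat * nat) := let: (b, j, N) := q in
  if (b + j.+1 <= N)%N then ((b + j.+1)%N, j, N)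
  else let: (N', r, k0) := g (b, j.+1) in ((r + k0 * j.+2)%N, j.+1, N').
pose st k := iter k step (0%N, 0%N, 0%N).
pose b k := (st k).1.1; pose j k := (st k).1.2.
have stS k : ((b k + (j k).+1 <= b k.+1) /\ (j k <= j k.+1 <= (j k).+1))%N.
  rewrite /b /j /st iterS; case: (iter k step _) => [[p s] N] /=.
  case: ifPn => [_|_] /=; first by lia.
  have := gP (p, s.+1); case: (g _) => [[N' r] k0] /= [+ _ _ _]; lia.
have jm : {homo j : m n / (m <= n)%N}.
  apply: homo_leq => [|? ? ?|k]; [exact: leqnn|exact: leq_trans|].
  by case: (stS k); lia.
have jk k : (j k <= k)%N.
  by elim: k => [//|k IH]; have [_] := stS k; lia.
have run p s N m K : st K = (p, s, N) -> (p + m * s.+1 <= N)%N ->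
    forall i, (i <= m)%N -> st (K + i)%N = ((p + i * s.+1)%N, s, N).
  move=> stK le; elim => [_|i IH im]; first by rewrite addn0 mul0n addn0.
  rewrite addnS /st iterS -/(st _) IH ?(ltnW im)//= ifT; last first.
    apply: leq_trans le; rewrite -addnA leq_add2l -mulSnr leq_mul2r.
    by rewrite im orbT.
  by congr (_, _, _); rewrite mulSnr addnA.
(* Every stage is reached and places exactly [m] blocks. Stage 0 carries no cost bound: its state is
   the initial one and not a choice of [g]. *)
have stage s : exists K p N m, [/\ st K = (p, s, N), (p + m * s.+1 <= N)%N,
    (N < p + m.+1 * s.+1)%N & (0 < s)%N ->
    e / 2 * N%:R < \sum_(0 <= k < m) c (p + k * s.+1)%N (p + k.+1 * s.+1)%N].
  elim: s => [|s [K [p [N [m [stK le lt _]]]]]].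
    by exists 0%N, 0%N, 0%N, 0%N; split.
  have stKm := run _ _ _ _ _ stK le m (leqnn m).
  have := gP ((p + m * s.+1)%N, s.+1).
  case gE : (g _) => [[N' r] k0] /= [_ k0N rN big].
  pose m' := ((N' - r) %/ s.+2 - k0)%N.
  have sum_m : (r + k0 * s.+2 + m' * s.+2 = r + (N' - r) %/ s.+2 * s.+2)%N.
    by rewrite -addnA -mulnDl subnKC.
  have dvE := divn_eq (N' - r) s.+2.
  have := ltn_pmod (N' - r) (ltn0Sn s.+1) => md.
  exists (K + m).+1, (r + k0 * s.+2)%N, N', m'; split.
  - rewrite /st iterS -/(st _) stKm /= gE; case: ifPn => //.
    by rewrite -addnA -mulSnr; move: lt; rewrite ltnNge => /negbTE ->.
  - by rewrite sum_m; lia.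
  - by rewrite mulSnr addnA sum_m; lia.
  - move=> _; apply: (lt_le_trans big).
    rewrite -{1}(add0n k0) big_addn -/m'; apply: ler_sum => i _.
    by rewrite -!addnA -!mulnDl addnS (addnC i).
have jge s : exists2 K, (s <= K)%N & forall k, (K <= k)%N -> (s <= j k)%N.
  have [K [p [N [m [stK _ _ _]]]]] := stage s.
  have jK : j K = s by rewrite /j stK.
  by exists K; [rewrite -jK|move=> k /jm; rewrite jK].
have blk : block_sequence b.
  split => [//|k|].
    by have [+ _] := stS k; lia.
  apply/cvgnyPge => A; have [K _ Kk] := jge A.
  exists K => // k /= /Kk; have [+ _] := stS k; lia.
have e2 : 0 < e / 2 by rewrite divr_gt0.
have /cvgrPdist_lt/(_ _ e2)[K0 _ HK0] := Hb b blk.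
(* When stage [K0.+1] ends, the breakpoint is at most [N], while the blocks of that stage alone cost
   more than [e / 2 * N]. So the block average exceeds [e / 2] at the index [K + m], beyond [K0]. *)
have [K [p [N [m [stK le lt]]]]] := stage K0.+1.
move=> /(_ isT) big.
have jK : j K = K0.+1 by rewrite /j stK.
have /HK0 : (K0 <= K + m)%N by have := jk K; rewrite jK; lia.
rewrite /=.
have bKi i : (i <= m)%N -> b (K + i)%N = (p + i * K0.+2)%N.
  by move=> im; rewrite /b (run _ _ _ _ _ stK le).
have bKm0 : (0 < b (K + m))%N.
  case E : (K + m)%N => [|i]; last by have [+ _] := stS i; lia.
  by have := jk K; rewrite jK; lia.
have S0 (A : nat) : 0 <= \sum_(i < A) c (b i) (b i.+1) by apply: sumr_ge0.
rewrite sub0r normrN ger0_norm ?mulr_ge0 ?invr_ge0 ?S0//.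
rewrite ltNge => /negP; apply.
rewrite [leRHS]mulrC ler_pdivlMr ?ltr0n//.
have -> : \sum_(i < K + m) c (b i) (b i.+1) =
    \sum_(i < K) c (b i) (b i.+1) +
    \sum_(0 <= k < m) c (p + k * K0.+2)%N (p + k.+1 * K0.+2)%N.
  rewrite -!(big_mkord xpredT (fun i => c (b i) (b i.+1))).
  rewrite (@big_cat_nat _ _ _ K 0 (K + m))//= ?leq_addr//; congr (_ + _).
  rewrite -[X in \big[_/_]_(X <= _ < _) _]add0n big_addn addKn.
  apply: eq_big_nat => i /andP[_ im].
  by rewrite addnC -addnS !bKi// ltnW.
apply: le_trans (_ : e / 2 * N%:R <= _).
  by rewrite ler_wpM2l ?(ltW e2)// ler_nat bKi.
  by rewrite (le_trans (ltW big))// lerDr.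
Qed.

End window_averages.

(** * Invariant measures from visit frequencies *)

Section finitely_additive_extension.
Variables (R : realType) (T : pointedMetricType R).
Hypothesis T_compact : compact [set: T].
Variable m : set T -> R.
Hypotheses (m_ge0 : forall A, 0 <= m A) (m_setT : m setT = 1).
Hypothesis m_setU :
  forall A B, A `&` B = set0 -> m (A `|` B) = m A + m B.

Lemma le_content A B : A `<=` B -> m A <= m B.
Proof.
move=> AB; rewrite -(setDUK AB) m_setU ?lerDl//.
by apply/disjoints_subset => x Ax [_ /(_ Ax)].
Qed.

Lemma content_set0 : m set0 = 0.
Proof.
have := m_setU (setI0 (@set0 T)); rewrite setU0 => /eqP.
by rewrite -subr_eq0 opprD addrA subrr sub0r oppr_eq0 => /eqP.
Qed.

Lemma content_setU_le A B : m (A `|` B) <= m A + m B.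
Proof.
rewrite -(setDUK (@subsetUl _ A B)) m_setU; last first.
  by apply/disjoints_subset => x Ax [_ /(_ Ax)].
by rewrite lerD2l le_content// => x [[]].
Qed.

(** The classical passage from a content to a regular measure: approximation from inside by closed
    sets, used for open [U], then approximation from outside by open sets. The measure obtained may
    exceed [m] on a closed set. *)
Definition inner_content (U : set T) : \bar R :=
  ereal_sup [set (m C)%:E | C in [set C | closed C /\ C `<=` U]].

Definition outer_content (A : set T) : \bar R :=
  ereal_inf [set inner_content U | U in [set U | open U /\ A `<=` U]].

Local Open Scope ereal_scope.

Lemma inner_content_lb C U : closed C -> C `<=` U -> (m C)%:E <= inner_content U.
Proof. by move=> cC CU; apply: ereal_sup_ubound; exists C. Qed.

Lemma inner_content_ge0 U : 0 <= inner_content U.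
Proof.
have <- : (m set0)%:E = 0 by rewrite content_set0.
by apply: inner_content_lb => //; exact: closed0.
Qed.

Lemma inner_content_le1 U : inner_content U <= 1.
Proof.
by apply: ge_ereal_sup => _ [C _ <-]; rewrite lee_fin -m_setT le_content.
Qed.

Lemma le_inner_content U V : U `<=` V -> inner_content U <= inner_content V.
Proof.
move=> UV; apply: ge_ereal_sup => _ [C [cC CU] <-].
by apply: inner_content_lb => //; exact: subset_trans UV.
Qed.

Lemma outer_content_le A U : open U -> A `<=` U -> outer_content A <= inner_content U.
Proof. by move=> oU AU; apply: ereal_inf_lbound; exists U. Qed.

Lemma outer_content_open U : open U -> outer_content U = inner_content U.
Proof.
move=> oU; apply/eqP; rewrite eq_le outer_content_le//=.
by apply: le_ereal_inf_tmp => _ [V [oV UV] <-]; exact: le_inner_content.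
Qed.

Lemma outer_content_ge0 A : 0 <= outer_content A.
Proof. by apply: le_ereal_inf_tmp => _ [U _ <-]; exact: inner_content_ge0. Qed.

Lemma outer_content_fin A : outer_content A \is a fin_num.
Proof.
rewrite ge0_fin_numE ?outer_content_ge0//.
apply: (@le_lt_trans _ _ (inner_content setT)).
  by apply: outer_content_le => //; exact: openT.
by rewrite (le_lt_trans (inner_content_le1 _))// ltry.
Qed.

Lemma inner_content_fin U : inner_content U \is a fin_num.
Proof.
rewrite ge0_fin_numE ?inner_content_ge0//.
by rewrite (le_lt_trans (inner_content_le1 _))// ltry.
Qed.

Lemma le_outer_content A B : A `<=` B -> outer_content A <= outer_content B.
Proof.
move=> AB; apply: le_ereal_inf_tmp => _ [U [oU BU] <-].
by apply: outer_content_le => //; exact: subset_trans BU.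
Qed.

(** The parts of [C] outside [U n] and outside the union of the earlier sets are disjoint and
    closed. Normality separates them by open [Q] and [P], and [C] is the union of the closed sets
    [C] minus [P] and [C] minus [Q], to which induction and the definition apply. *)
Lemma content_bigcup_ord (U : nat -> set T) n C : (forall i, open (U i)) ->
  closed C -> C `<=` \bigcup_(i < n) U i ->
  (m C)%:E <= \sum_(i < n) inner_content (U i).
Proof.
move=> oU; elim: n C => [|n IH] C cC CU.
  rewrite big_ord0 (_ : C = set0) ?content_set0//.
  by rewrite -subset0 => x /CU[].
have /(@normal_openP R) := @pseudometric_normal R T.
pose V := \bigcup_(i < n) U i.
have oV : open V by apply: bigcup_open.
move=> /(_ (C `&` ~` V) (C `&` ~` U n))[].
- by apply: closedI => //; exact: open_closedC.
- by apply: closedI => //; exact: open_closedC.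
- rewrite -subset0 => x [[Cx nVx] [_ nUx]].
  have [i /= ] := CU x Cx; rewrite ltnS leq_eqVlt => /predU1P[->//|ni Ux].
  by apply: nVx; exists i.
move=> P [Q [oP oQ CP CQ PQ0]].
have CE : C `<=` (C `&` ~` P) `|` (C `&` ~` Q).
  move=> x Cx; have [Px|nPx] := pselect (P x); last by left.
  by right; split => // Qx; have : (P `&` Q) x by []; rewrite PQ0.
rewrite big_ord_recr/=; apply: (@le_trans _ _ ((m (C `&` ~` P))%:E +
    (m (C `&` ~` Q))%:E)).
  by rewrite -EFinD lee_fin (le_trans (le_content CE))// content_setU_le.
apply: leeD; last first.
  apply: inner_content_lb; first by apply: closedI => //; exact: open_closedC.
  by move=> x [Cx nQx]; apply: contrapT => nU; apply: nQx; exact: CQ.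
apply: IH; first by apply: closedI => //; exact: open_closedC.
by move=> x [Cx nPx]; apply: contrapT => nU; apply: nPx; exact: CP.
Qed.

(** A closed subset of the union is compact, hence covered by finitely many [U i]. *)
Lemma inner_content_bigcup (U : nat -> set T) : (forall i, open (U i)) ->
  inner_content (\bigcup_i U i) <= \sum_(i <oo) inner_content (U i).
Proof.
move=> oU; apply: ge_ereal_sup => _ [C [cC CU] <-].
have cptC : compact C by exact: subclosed_compact T_compact _.
have /compact_near_coveringP cov := cptC.
have [|n _ /(_ n (leqnn n)) Cn] :=
    cov nat \oo (fun n x => (\bigcup_(i < n) U i) x) _.
  move=> x /CU[k _ Ukx]; exists (U k, [set n | (k < n)%N]) => /=.
    split; first exact: open_nbhs_nbhs.
    by exists k.+1.
  by move=> [y n] /= [Uy kn]; exists k.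
apply: le_trans (content_bigcup_ord oU cC Cn) _.
rewrite -(big_mkord xpredT (fun i => inner_content (U i))).
by apply: nneseries_lim_ge => *; exact: inner_content_ge0.
Qed.

Lemma outer_content_bigcup (A : nat -> set T) :
  outer_content (\bigcup_i A i) <= \sum_(i <oo) outer_content (A i).
Proof.
apply/lee_addgt0Pr => e e0.
have ex i : exists U, [/\ open U, A i `<=` U &
    inner_content U <= outer_content (A i) + (e / (2 ^ i.+1)%:R)%:E].
  have ei0 : (0 < e / (2 ^ i.+1)%:R)%R by rewrite divr_gt0// ltr0n expn_gt0.
  have [_ [U [oU AU] <-] /ltW lt] :=
    lb_ereal_inf_adherent ei0 (outer_content_fin (A i)).
  by exists U.
have {ex}[U HU] := choice ex.
apply: (@le_trans _ _ (inner_content (\bigcup_i U i))).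
  apply: outer_content_le; first by apply: bigcup_open => i _; case: (HU i).
  by apply: subset_bigcup => i _; case: (HU i).
have oU i : open (U i) by case: (HU i).
apply: (le_trans (inner_content_bigcup oU)).
apply: (@le_trans _ _ (\sum_(i <oo) (outer_content (A i) + (e / (2 ^ i.+1)%:R)%:E))).
  apply: lee_nneseries => [i _ _|i _]; first exact: inner_content_ge0.
  by case: (HU i).
by apply: epsilon_trick; [move=> i; exact: outer_content_ge0|exact: ltW].
Qed.

Lemma outer_content_set0 : outer_content set0 = 0.
Proof.
rewrite outer_content_open; last exact: open0.
apply/eqP; rewrite eq_le inner_content_ge0 andbT.
apply: ge_ereal_sup => _ [C [_ +] <-]; rewrite subset0 => ->.
by rewrite content_set0.
Qed.

Let outer_content_isOuter := isOuterMeasure.Build R T outer_content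
  outer_content_set0 outer_content_ge0 le_outer_content outer_content_bigcup.

Let mu : {outer_measure set T -> \bar R} :=
  HB.pack outer_content outer_content_isOuter.

(** For open [U] containing [A], choose a closed [C] inside [U] and [V], then a closed [D] inside
    [U] minus [C]. They are disjoint, so [m C + m D] is the content of a closed subset of [U]; the
    suprema over [D] and [C] give the inequality. *)
Lemma open_caratheodory V : open V -> (mu.-caratheodory V)%classic.
Proof.
move=> oV; apply: le_caratheodory_measurable => A /=.
apply: le_ereal_inf_tmp => _ [U [oU AU] <-].
have AVU : outer_content (A `&` V) <= inner_content (U `&` V).
  by apply: outer_content_le; [exact: openI|exact: setSI].
apply: (le_trans (leeD AVU (lexx _))).
rewrite -leeBrDr ?outer_content_fin//.
apply: ge_ereal_sup => _ [C [cC CUV] <-].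
rewrite leeBrDr ?outer_content_fin// addeC -leeBrDr//.
have ACU : outer_content (A `&` ~` V) <= inner_content (U `&` ~` C).
  apply: outer_content_le; first by apply: openI => //; exact: closed_openC.
  by move=> x [/AU Ux nVx]; split => // /CUV[].
apply: (le_trans ACU); apply: ge_ereal_sup => _ [D [cD DUC] <-].
rewrite leeBrDr// -EFinD addrC -m_setU; last first.
  by apply/disjoints_subset => x Cx /DUC[].
apply: inner_content_lb; first exact: closedU.
by move=> x [/CUV[]|/DUC[]].
Qed.

Lemma borel_caratheodory A : <<s @open T >> A -> (mu.-caratheodory A)%classic.
Proof.
apply: smallest_sub; last exact: open_caratheodory.
split; first exact: caratheodory_measurable_set0.
  by move=> B mB; rewrite setTD; exact: caratheodory_measurable_setC.
exact: caratheodory_measurable_bigcup.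
Qed.

Lemma outer_content_sigma_additive :
  semi_sigma_additive (outer_content : set (borel T) -> \bar R).
Proof.
move=> F mF tF mUF.
apply: (@caratheodory_measure_sigma_additive R T mu F) => //.
  by move=> i; exact: (borel_caratheodory (mF i)).
exact: (borel_caratheodory mUF).
Qed.

Lemma finitely_additive_extension : exists P : probability (borel T) R,
  forall U : set T, open U -> P U = inner_content U.
Proof.
pose M := isMeasure.Build _ (borel T) R outer_content outer_content_set0
  outer_content_ge0 outer_content_sigma_additive.
have PT : outer_content (setT : set (borel T)) = 1%E.
  rewrite outer_content_open; last exact: openT.
  apply/eqP; rewrite eq_le inner_content_le1 -m_setT/=.
  by apply: inner_content_lb => //; exact: closedT.
pose mP : {measure set (borel T) -> \bar R} := HB.pack outer_content M.
pose P : probability (borel T) R := HB.pack outer_content M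
  (Measure_isProbability.Build _ (borel T) R mP PT).
by exists P => U oU; rewrite -outer_content_open.
Qed.

End finitely_additive_extension.

(** * Limit frequencies of visits along an ultrafilter *)

Section visit_frequencies.
Variables (R : realType) (T : pointedMetricType R) (S : T -> T).
Hypotheses (T_compact : compact [set: T]) (S_continuous : continuous S).

Lemma continuous_borel_measurable_fun :
  measurable_fun [set: borel T] (S : borel T -> borel T).
Proof.
apply: (@measurability _ _ (borel T) (borel T) setT S (@open T)) => //.
move=> _ [U oU <-]; rewrite setTI; apply: sub_sigma_algebra.
by apply: open_comp => // x _; exact: S_continuous.
Qed.

(** The image of [P] under [S] agrees with [P] on the open sets, a generating family stable under
    intersection. *)
Lemma invariant_measure_open (P : probability (borel T) R) :
  (forall U : set T, open U -> P (S @^-1` U) = P U) -> invariant_measure S P.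
Proof.
move=> PS A mA.
pose X : {RV P >-> borel T} :=
  HB.pack S (isMeasurableFun.Build _ _ (borel T) (borel T) S
    continuous_borel_measurable_fun).
pose Q : probability (borel T) R := distribution P X.
apply: (@measure_unique _ R (borel T) (@open T) (fun=> setT) _ _ _ _ Q P) => //.
- exact: openI.
- by move=> _; exact: openT.
- by rewrite bigcup_const.
- by move=> _; rewrite (le_lt_trans (probability_le1 _ _))// ltry.
Qed.

Definition visit_frequency (x : T) (A : set T) (N : nat) : R :=
  N%:R^-1 * \sum_(n < N) \1_A (iter n S x).

Lemma indic01 (A : set T) x : 0 <= (\1_A x : R) <= 1.
Proof. by rewrite indicE; case: (x \in A); rewrite ?ler01 ?lexx. Qed.

Lemma visit_frequency01 x A N : 0 <= visit_frequency x A N <= 1.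
Proof.
have s0 : 0 <= \sum_(n < N) (\1_A (iter n S x) : R).
  by apply: sumr_ge0 => i _; case/andP: (indic01 A (iter i S x)).
rewrite /visit_frequency mulr_ge0 ?invr_ge0//=.
case: N s0 => [|N] s0; first by rewrite big_ord0 mulr0.
rewrite ler_pdivrMl// mulr1.
apply: (@le_trans _ _ (\sum_(n < N.+1) 1)); last by rewrite sumr_const card_ord.
by apply: ler_sum => i _; case/andP: (indic01 A (iter i S x)).
Qed.

Variables (x : T) (F : set_system nat).
Hypotheses (F_ultra : UltraFilter F) (F_oo : \oo `<=` F).

(** The image of an ultrafilter is an ultrafilter, and it contains the compact interval from 0 to
    1. *)
Lemma visit_frequency_ultra_cvg A :
  exists l : R, visit_frequency x A N @[N --> F] --> l.
Proof.
have FP : ProperFilter F by exact: ultra_proper.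
have U : UltraFilter (visit_frequency x A N @[N --> F]).
  split => [|G GP FG]; first exact: fmap_proper_filter.
  apply/seteqP; split => // B GB /=.
  have [//|nB] := in_ultra_setVsetC (visit_frequency x A @^-1` B) F_ultra.
  have /filter_ex[z []] : G (B `&` ~` B) by apply: filterI => //; exact: FG.
  by [].
have := @segment_compact R 0 1; rewrite compact_ultra => /(_ _ U)[].
  suff : F (visit_frequency x A @^-1` `[0, 1]) by [].
  by apply: filterS filterT => N _ /=; rewrite in_itv/= visit_frequency01.
by move=> l [_ ?]; exists l.
Qed.

Definition limit_frequency (A : set T) : R :=
  projT1 (cid (visit_frequency_ultra_cvg A)).

Lemma limit_frequency_cvg A :
  visit_frequency x A N @[N --> F] --> limit_frequency A.
Proof. by rewrite /limit_frequency; case: cid. Qed.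

Let FP : ProperFilter F. Proof. exact: ultra_proper. Qed.

Lemma limit_frequency_unique A (l : R) :
  visit_frequency x A N @[N --> F] --> l -> limit_frequency A = l.
Proof.
by move=> cvl; exact: norm_cvg_unique (@limit_frequency_cvg A) cvl.
Qed.

Lemma limit_frequency_ge0 A : 0 <= limit_frequency A.
Proof.
apply: (closed_cvg (fun y : R => 0 <= y) (@closed_ge R 0) _ _
  (@limit_frequency_cvg A)).
by apply: filterS filterT => N _; case/andP: (visit_frequency01 x A N).
Qed.

Lemma limit_frequency_setU A B : A `&` B = set0 ->
  limit_frequency (A `|` B) = limit_frequency A + limit_frequency B.
Proof.
move=> AB0; apply: limit_frequency_unique.
have -> : visit_frequency x (A `|` B) =
    visit_frequency x A \+ visit_frequency x B.
  apply/funext => N; rewrite /visit_frequency /= -mulrDr -big_split/=.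
  congr (_ * _); apply: eq_bigr => i _; rewrite !indicE in_setU.
  case: (boolP (_ \in A)) => /= [Ai|]; last by rewrite add0r.
  rewrite [X in _ + X](_ : _ = 0) ?addr0//; case: (boolP (_ \in B)) => // Bi.
  have : (A `&` B) (iter i S x) by split; exact: set_mem.
  by rewrite AB0.
by apply: cvgD; exact: limit_frequency_cvg.
Qed.

Lemma ultra_gt0 : \forall N \near F, (0 < N)%N.
Proof. by apply: F_oo; exists 1%N. Qed.

Lemma limit_frequency_setT : limit_frequency setT = 1.
Proof.
apply: limit_frequency_unique; apply: cvg_near_cst.
apply: filterS ultra_gt0 => N N0; rewrite /visit_frequency.
under eq_bigr do rewrite indicT.
by rewrite sumr_const card_ord mulVf// pnatr_eq0 -lt0n.
Qed.

(** The two visit counts differ only by the terms at times 0 and [N], hence the frequencies by at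
    most [N%:R^-1]. *)
Lemma limit_frequency_preimage A : limit_frequency (S @^-1` A) = limit_frequency A.
Proof.
apply: limit_frequency_unique.
have -> : visit_frequency x (S @^-1` A) = visit_frequency x A \+
    (fun N => N%:R^-1 * (\1_A (iter N S x) - \1_A x)).
  apply/funext => N; rewrite /visit_frequency /= -mulrDr; congr (_ * _).
  transitivity (\sum_(n < N) (\1_A (iter n.+1 S x) : R)).
    by apply: eq_bigr => i _; rewrite !indicE.
  have : \sum_(i < N.+1) (\1_A (iter i S x) : R) =
      \1_A x + \sum_(i < N) \1_A (iter i.+1 S x) by rewrite big_ord_recl.
  by rewrite big_ord_recr/=; lra.
rewrite -[limit_frequency A]addr0; apply: cvgD; first exact: limit_frequency_cvg.
apply: (@cvg_trans _ (N%:R^-1 * (\1_A (iter N S x) - \1_A x) @[N --> \oo])).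
  by move=> B /= /F_oo.
apply/cvgr0Pnorm_le => e e0.
have : (N%:R^-1 : R) @[N --> \oo] --> (0 : R).
  by rewrite -(cvg_shiftS (fun N => N%:R^-1 : R)); exact: cvg_harmonic.
move=> /cvgr0Pnorm_le/(_ _ e0).
apply: filterS => N; apply: le_trans.
rewrite normrM ler_piMr//.
have := indic01 A x; have := indic01 A (iter N S x).
by rewrite ler_norml; lra.
Qed.

(* Images and preimages under [S] of closed sets are closed, so the inner content
   of the limit frequency, hence the measure it induces, is again invariant. *)
Lemma invariant_measure_frequency : exists2 P : probability (borel T) R,
  invariant_measure S P &
  forall C, closed C -> ((limit_frequency C)%:E <= P C)%E.
Proof.
pose m := limit_frequency.
have m1 : m setT = 1 by exact: limit_frequency_setT.
have mU : forall A B, A `&` B = set0 -> m (A `|` B) = m A + m B.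
  by move=> A B; exact: limit_frequency_setU.
have m0 A : 0 <= m A by exact: limit_frequency_ge0.
have [P PE] := finitely_additive_extension T_compact m0 m1 mU.
exists P.
  apply: invariant_measure_open => U oU.
  rewrite !PE//; last by apply: open_comp => // y _; exact: S_continuous.
  apply/eqP; rewrite eq_le; apply/andP; split.
    apply: ge_ereal_sup => _ [C [cC CU] <-].
    have SC : m C <= m (S @` C).
      rewrite -[m (S @` C)]limit_frequency_preimage.
      by apply: (le_content m0 mU) => y Cy; exists y.
    apply: (@le_trans _ _ (m (S @` C))%:E); first by rewrite lee_fin.
    apply: inner_content_lb; last by move=> _ [y /CU Uy <-].
    apply: compact_closed; first exact: metric_hausdorff.
    apply: continuous_compact; first exact: continuous_subspaceT.
    exact: subclosed_compact T_compact _.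
  apply: ge_ereal_sup => _ [C [cC CU] <-].
  rewrite -[m C]limit_frequency_preimage.
  apply: inner_content_lb; last by move=> y /CU.
  by apply: closed_comp => // y _; exact: S_continuous.
move=> C cC.
have oC : open (~` C) by exact: closed_openC.
have mC : measurable (~` C : set (borel T)) by exact: sub_sigma_algebra.
rewrite -(setCK C) probability_setC// setCK PE//.
have : (inner_content m (~` C) <= (1 - m C)%:E)%E.
  apply: ge_ereal_sup => _ [D [_ DC] <-]; rewrite lee_fin lerBrDr -m1.
  rewrite -mU; last exact/disjoints_subset.
  exact: le_content.
rewrite EFinB leeBrDr// => inner_le.
by rewrite leeBrDr 1?addeC//; exact: inner_content_fin.
Qed.

End visit_frequencies.

(** If the bound failed for arbitrarily large [N], an ultrafilter containing the set [bad] of these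
    [N] would yield an invariant probability giving [C] mass at least [fine (nu C) + e], against
    uniqueness of [nu]. *)
Lemma closed_visits_le (R : realType) (T : pointedMetricType R) (S : T -> T)
    (nu : probability (borel T) R) (x : T) (C : set T) (e : R) :
  topological_dynamical_system S -> uniquely_ergodic S nu ->
  closed C -> 0 < e ->
  \forall N \near \oo,
    \sum_(n < N) (\1_C (iter n S x) : R) <= (fine (nu C) + e) * N%:R.
Proof.
move=> [cT cS] [_ nu_unique] cC e0; apply: contrapT => nN.
pose bad := [set N |
  (fine (nu C) + e) * N%:R < \sum_(n < N) (\1_C (iter n S x) : R)].
have PW : ProperFilter (within bad \oo).
  split; last exact: within_filter.
  by rewrite /within /= => H; apply: nN; apply: filterS H => N /=;
    rewrite leNgt => H; apply/negP.
have [F [UF WF]] := ultraFilterLemma PW.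
have F_oo : \oo `<=` F.
  by move=> A [N _ NA]; apply: WF; exists N => // n /NA.
have Fbad : F bad by apply: WF; exact: withinT.
have [P Pinv Pge] := invariant_measure_frequency cT cS x UF F_oo.
have mC : measurable (C : set (borel T)).
  by rewrite -(setCK C); apply: measurableC; apply: sub_sigma_algebra;
    exact: closed_openC.
have := Pge C cC; rewrite nu_unique// -[nu C]fineK ?fin_num_measure// lee_fin.
apply/negP; rewrite -ltNge.
have FP : ProperFilter F by exact: ultra_proper.
apply: (@lt_le_trans _ _ (fine (nu C) + e)); first by rewrite ltrDl.
apply: (closed_cvg (fun y => fine (nu C) + e <= y) (@closed_ge R _) _ _
  (@limit_frequency_cvg _ _ S x F UF C)).
have : \forall N \near F, (0 < N)%N by apply: F_oo; exists 1%N.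
apply: filterS2 Fbad => N /ltW bN N0.
by rewrite /visit_frequency mulrC ler_pdivlMr ?ltr0n.
Qed.

(** * Regularity and approximation *)

Lemma probability_decreasing_small (R : realType) d (T : measurableType d)
    (P : probability T R) (E : (set T)^nat) (e : R) :
  (forall n, measurable (E n)) -> {homo E : m n / (m <= n)%N >-> n `<=` m} ->
  \bigcap_n E n = set0 -> 0 < e -> exists n, (P (E n) < e%:E)%E.
Proof.
move=> mE dE E0 e0.
have : (P \o E) n @[n --> \oo] --> P (\bigcap_n E n).
  apply: nonincreasing_cvg_mu => //.
  - by rewrite (le_lt_trans (probability_le1 _ _))// ltry.
  - by rewrite E0.
  - by move=> m n mn; apply/subsetPset; exact: dE.
rewrite E0 measure0 => /fine_cvgP[_ /cvgr0Pnorm_lt/(_ _ e0)[n _ /(_ n (leqnn n))]].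
move=> /ltr_normlP[_ /=] lt; exists n.
by rewrite -[P _]fineK ?fin_num_measure// lte_fin.
Qed.

Section regularity.
Variables (R : realType) (T : pointedMetricType R) (P : probability (borel T) R).

Definition inner_outer_regular (A : set T) :=
  measurable (A : set (borel T)) /\ forall e : R, 0 < e -> exists C U : set T,
    [/\ closed C, open U, C `<=` A, A `<=` U & (P (U `\` C) < e%:E)%E].

Lemma open_borel (U : set T) : open U -> measurable (U : set (borel T)).
Proof. exact: sub_sigma_algebra. Qed.

Lemma closed_borel (C : set T) : closed C -> measurable (C : set (borel T)).
Proof.
by move=> cC; rewrite -(setCK C); apply: measurableC; apply: open_borel;
  exact: closed_openC.
Qed.

Lemma inner_outer_regular_open (U : set T) : open U -> inner_outer_regular U.
Proof.
move=> oU; split=> [|e e0]; first exact: open_borel.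
(* These are shrinking open neighbourhoods of the complement of [U]; their complements are closed
   sets that exhaust [U]. *)
pose V n := \bigcup_(y in ~` U) (ball y (n.+1%:R^-1 : R))°.
have oV n : open (V n) by apply: bigcup_open => y _; exact: open_interior.
have UV n : U `\` ~` V n = U `&` V n by rewrite setDE setCK.
have [|m n mn x||n Pn] := @probability_decreasing_small _ _ _ P
    (fun n => U `&` V n) e _ _ _ e0.
- by move=> n; apply: open_borel; exact: openI.
- move=> [Ux [y nUy Vx]]; split => //; exists y => //.
  move: x Vx {Ux}; apply: interiorS; apply: le_ball.
  by rewrite lef_pV2 ?posrE ?ltr0n// ler_nat.
- rewrite -subset0 => x UVx.
  have [Ux _] := UVx 0%N Logic.I.
  have : nbhs x U by exact: open_nbhs_nbhs.
  rewrite -nbhs_ballE => -[_/posnumP[r] rU].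
  have [n _ /(_ n (leqnn n))/= nr] := near_infty_natSinv_lt r.
  have [_ [y nUy /interior_subset yx]] := UVx n Logic.I.
  by apply: nUy; apply: rU; apply: (le_ball (ltW nr)); exact: ball_sym.
exists (~` V n), U; rewrite UV; split => //; first exact: open_closedC.
move=> x nVx; apply: contrapT => nUx; apply: nVx; exists x => //.
by apply: nbhs_singleton; apply: nbhs_interior; exact: nbhsx_ballx.
Qed.

Lemma inner_outer_regularC (A : set T) :
  inner_outer_regular A -> inner_outer_regular (~` A).
Proof.
move=> [mA rA]; split=> [|e e0]; first exact: measurableC.
have [C [U [cC oU CA AU lt]]] := rA e e0.
exists (~` U), (~` C); split; [exact: open_closedC|exact: closed_openC| | |].
- exact: subsetC.
- exact: subsetC.
- by rewrite setDE setCK setIC -setDE.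
Qed.

(** Half of [e] is spread geometrically over the approximations of the [A n]. The other half pays
    for truncating the union of the closed sets [C i], which need not be closed, to the finite union
    [CC n]. *)
Lemma inner_outer_regular_bigcup (A : (set T)^nat) :
  (forall n, inner_outer_regular (A n)) -> inner_outer_regular (\bigcup_n A n).
Proof.
move=> rA.
split=> [|e e0]; first by apply: bigcupT_measurable => n; case: (rA n).
have ex n : exists CU : set T * set T, [/\ closed CU.1, open CU.2,
    CU.1 `<=` A n, A n `<=` CU.2 &
    (P (CU.2 `\` CU.1) <= (e / 2 / (2 ^ n.+1)%:R)%:E)%E].
  have [_ /(_ (e / 2 / (2 ^ n.+1)%:R))[|C [U [? ? ? ? /ltW ?]]]] := rA n.
    by rewrite !divr_gt0// ltr0n expn_gt0.
  by exists (C, U).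
have {ex}[CU CUP] := choice ex.
pose C n := (CU n).1; pose U n := (CU n).2.
have cC n : closed (C n) by case: (CUP n).
have oU n : open (U n) by case: (CUP n).
have mUC n : measurable (U n `\` C n : set (borel T)).
  by apply: measurableD; [exact: open_borel|exact: closed_borel].
pose CC n := \bigcup_(i < n) C i.
have cCC n : closed (CC n) by apply: closed_bigcup.
have mE n : measurable (\bigcup_i C i `\` CC n : set (borel T)).
  apply: measurableD; last exact: closed_borel.
  by apply: bigcupT_measurable => i; exact: closed_borel.
have e20 : 0 < e / 2 by rewrite divr_gt0.
have [m n mn x||n Pn] := @probability_decreasing_small _ _ _ P
    (fun n => \bigcup_i C i `\` CC n) (e / 2) mE _ _ e20.
- move=> [Cx nCC]; split => // -[i /= im Cix]; apply: nCC; exists i => //=.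
  exact: leq_trans mn.
- rewrite -subset0 => x Cx; have [[i _ Ci] _] := Cx 0%N Logic.I.
  by have [_] := Cx i.+1 Logic.I; apply; exists i => /=.
exists (CC n), (\bigcup_i U i); split => //; first by apply: bigcup_open.
- by move=> x [i _ Cx]; exists i => //; case: (CUP i) => _ _ + _ _; exact.
- by apply: subset_bigcup => i _; case: (CUP i).
have sub : \bigcup_i U i `\` CC n `<=`
    \bigcup_i (U i `\` C i) `|` (\bigcup_i C i `\` CC n).
  move=> x [[i _ Ux] nCC]; have [Cx|nCx] := pselect (C i x).
    by right; split => //; exists i.
  by left; exists i.
have mUCs : measurable (\bigcup_i (U i `\` C i) : set (borel T)).
  exact: bigcupT_measurable.
apply: (@le_lt_trans _ _
  (P (\bigcup_i (U i `\` C i) `|` (\bigcup_i C i `\` CC n)))).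
  apply: le_measure => //; rewrite inE; last exact: measurableU.
  apply: measurableD; last exact: closed_borel.
  by apply: bigcupT_measurable => i; exact: open_borel.
apply: le_lt_trans (measureU2 P mUCs (mE n)) _.
rewrite [e](splitr e) EFinD; apply: lee_ltD => //.
  by rewrite fin_num_measure.
apply: le_trans (generalized_Boole_inequality P mUC mUCs) _.
apply: le_trans (epsilon_trick0 xpredT (ltW e20)).
by apply: lee_nneseries => // i _; case: (CUP i).
Qed.

Lemma borel_inner_regular (A : set (borel T)) (e : R) : measurable A -> 0 < e ->
  exists C : set T, [/\ closed C, C `<=` A & (P (A `\` C) < e%:E)%E].
Proof.
move=> mA e0; have [_ /(_ e e0)[C [U [cC oU CA AU lt]]]] :
    inner_outer_regular A.
  move: A mA; apply: smallest_sub; last exact: inner_outer_regular_open.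
  split => [|A rA|A rA].
  - by apply: inner_outer_regular_open; exact: open0.
  - by rewrite setTD; exact: inner_outer_regularC.
  - exact: inner_outer_regular_bigcup.
exists C; split => //; apply: le_lt_trans lt.
apply: le_measure; rewrite ?inE.
- by apply: measurableD => //; exact: closed_borel.
- by apply: measurableD; [exact: open_borel|exact: closed_borel].
- exact: setSD.
Qed.

End regularity.

Lemma compact_real_bounded (R : realType) (X : topologicalType) (f : X -> R) :
  compact [set: X] -> continuous f ->
  exists2 M : R, 0 < M & forall x, `|f x| <= M.
Proof.
move=> cX cf.
have : bounded_set (range f).
  apply: compact_bounded; apply: continuous_compact => //.
  exact: continuous_subspaceT.
move=> [M [_ /(_ (Num.max M 0 + 1))]] H.
exists (Num.max M 0 + 1).
  by rewrite ltr_pwDr// le_max lexx orbT.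
move=> x; apply: H; last by exists x.
by rewrite (@le_lt_trans _ _ (Num.max M 0))// ?le_max ?lexx// ltrDl.
Qed.

(** * Uniform continuity and finite covers in a compact group *)

Section compact_group.
Variables (G : topologicalZmodType).
Hypothesis G_compact : compact [set: G].

Lemma translate_continuous (g : G) : continuous (fun x : G => x + g).
Proof.
move=> x; apply: (@continuous_comp _ _ _ (fun x => (x, g))
  (fun x : G * G => x.1 + x.2)).
  by apply: cvg_pair; [exact: cvg_id|exact: cvg_cst].
exact: add_continuous.
Qed.

(** Each point [p] has a neighbourhood on which all small translations move [f] by less than [e];
    compactness of [X * G] gives one neighbourhood of 0 serving all points. *)
Lemma uniform_translates (R : realType) (X : topologicalType) (f : X * G -> R)
    (e : R) : compact [set: X] -> continuous f -> 0 < e ->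
  exists V : set G, [/\ open V, V 0 &
    forall x g v, V v -> `|f (x, g + v) - f (x, g)| < e].
Proof.
move=> cX cf e0.
have : compact [set: X * G].
  by rewrite -setXTT; exact: compact_setX.
move=> /compact_near_coveringP near_cov.
pose close_at v (p : X * G) := `|f (p.1, p.2 + v) - f p| < e.
have : nbhs (0 : G) [set v | setT `<=` close_at v].
  apply: near_cov => p _.
  pose h (q : (X * G) * G) : X * G := (q.1.1, q.1.2 + q.2).
  have ch : continuous h.
    move=> q; apply: cvg_pair.
      by apply: (cvg_comp _ _ (@cvg_fst _ _ _ _ _)); exact: cvg_fst.
    apply: (@continuous_comp _ _ _ (fun q : (X * G) * G => (q.1.2, q.2))
      (fun x : G * G => x.1 + x.2)); last exact: add_continuous.
    apply: cvg_pair; last exact: cvg_snd.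
    by apply: (cvg_comp _ _ (@cvg_fst _ _ _ _ _)); exact: cvg_snd.
  have : nbhs (p, 0) [set q | `|f (h q) - f q.1| < e].
    pose d q := f (h q) - f q.1.
    have cd : {for (p, 0), continuous d}.
      apply: (@cvgB _ _ _ (nbhs (p, 0 : G)) _ (f \o h) (f \o fst)).
        by apply: continuous_comp; [exact: ch|exact: cf].
      by apply: continuous_comp; [exact: cvg_fst|exact: cf].
    have d0 : d (p, 0) = 0 by rewrite /d /h/= addr0 -surjective_pairing subrr.
    have /cvgrPdist_lt/(_ _ e0) := cd.
    by apply: filterS => q /=; rewrite d0 sub0r normrN.
  case=> -[A B] /= [nA nB] ABd; by exists (A, B).
rewrite nbhsE => -[V [oV V0] HV]; exists V; split => // x g v /HV/(_ (x, g)).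
exact.
Qed.

Lemma finite_translates (V : set G) : open V -> V 0 ->
  exists (p : nat) (a : nat -> G), forall g, exists2 i, (i < p)%N & V (g - a i).
Proof.
move=> oV V0.
(* The filter of finite lists directed by inclusion: a near-covering along it produces a finite
   subcover. *)
pose F : set_system (seq G) :=
  [set A : set (seq G) |
     exists s : seq G, forall t : seq G, {subset s <= t} -> A t].
have FF : Filter F.
  split.
  - by exists [::].
  - move=> A B [s sA] [t tB]; exists (s ++ t) => r str; split.
      by apply: sA => x xs; apply: str; rewrite mem_cat xs.
    by apply: tB => x xt; apply: str; rewrite mem_cat xt orbT.
  - by move=> A B AB [s sA]; exists s => t /sA/AB.
move/compact_near_coveringP : G_compact => near_cov.
have [s Hs] : F [set s : seq G |
    setT `<=` [set g | exists2 a, a \in s & V (g - a)]].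
  apply: (near_cov _ F (fun s g => exists2 a, a \in s & V (g - a)) FF) => g _.
  exists ([set x | V (x - g)], [set s : seq G | g \in s]) => /=; last first.
    by move=> [x s] /= [Vx gs]; exists g.
  split; last by exists [:: g] => t; apply; rewrite mem_head.
  apply: open_nbhs_nbhs; split; last by rewrite /= subrr.
  by apply: open_comp => // x _; exact: translate_continuous.
have {}Hs := Hs s (fun x => id).
exists (size s), (nth 0 s) => g; have [a aS Va] := Hs g Logic.I.
by exists (index a s); rewrite ?index_mem// nth_index.
Qed.

End compact_group.

(** * Approximation of the transfer function *)

Section transfer_approximation.
Variables (R : realType) (Y : pointedMetricType R) (nu : probability (borel Y) R).
Hypothesis Y_compact : compact [set: Y].

(** Urysohn functions separating [K j] from the closed union of the other [K i] with [i < p]. *)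
Lemma closed_partition_bump (p : nat) (K : nat -> set Y) :
  (forall j, closed (K j)) -> trivIset setT K ->
  exists eta : nat -> Y -> R, [/\ forall j, continuous (eta j),
    forall j y, 0 <= eta j y <= 1 &
    forall i j y, (i < p)%N -> (j < p)%N -> K j y -> eta i y = (i == j)%:R].
Proof.
move=> cK tK.
have ex j : exists h : Y -> R, [/\ continuous h, forall y, 0 <= h y <= 1,
    forall y, K j y -> h y = 1 &
    forall i y, (i < p)%N -> i != j -> K i y -> h y = 0].
  pose L := \bigcup_(i in [set i | (i < p)%N /\ i != j]) K i.
  have cL : closed L.
    apply: closed_bigcup => //; apply: (sub_finite_set _ (finite_II p)).
    by move=> i [].
  have LK : L `&` K j = set0.
    rewrite -subset0 => y [[i [_ /eqP ij] Ki] Kj].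
    by apply: ij; apply: tK => //; exists y.
  have /(@normal_separatorP R) sep := @pseudometric_normal R Y.
  have /(@uniform_separatorP _ R)[h [ch h01 h0 h1]] := sep _ _ cL (cK j) LK.
  exists h; split => //.
  - by move=> y; have := h01 (h y); rewrite /= in_itv/=; apply; exists y.
  - by move=> y Ky; apply: h1; exists y.
  - by move=> i y ip ij Ky; apply: h0; exists y => //; exists i.
have [eta etaP] := choice ex; exists eta; split.
- by move=> j; case: (etaP j).
- by move=> j; case: (etaP j).
- move=> i j y ip jp Kj; case: (etaP i) => _ _ h1 h0.
  have [ij|ij] := eqVneq i j; first by rewrite ij in h1 *; apply: h1.
  by apply: (h0 j) => //; rewrite eq_sym.
Qed.

Variables (G : topologicalZmodType) (psi : Y -> G) (f : Y * G -> R) (e : R).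
Hypotheses (G_compact : compact [set: G]) (psi_meas : borel_measurable psi).
Hypotheses (f_cont : continuous f) (e_gt0 : 0 < e).

(* Lusin's theorem for [psi], in a form avoiding extensions of [G]-valued maps:
   off a set of small measure, [psi] is within [V] of a function taking finitely
   many values on disjoint closed sets. *)
Lemma transfer_approximation : exists (p : nat) (B : R), 0 < B /\
  forall d, 0 < d -> exists (K : set Y) (theta : nat -> Y -> R),
  [/\ closed K, (nu (~` K) < d%:E)%E, forall i, continuous (theta i),
    forall i y, `|theta i y| <= B &
    forall g, exists2 i, (i < p)%N &
      forall y, K y -> `|f (y, psi y + g) - theta i y| < 2 * e].
Proof.
have [V [oV V0 fV]] := uniform_translates G_compact Y_compact f_cont e_gt0.
have [p [a aP]] := finite_translates G_compact oV V0.
have cYG : compact [set: Y * G] by rewrite -setXTT; exact: compact_setX.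
have [M M0 fM] := compact_real_bounded cYG f_cont.
exists p, (p%:R * M + 1); split.
  by rewrite ltr_wpDl// mulr_ge0// ltW.
move=> d d0.
pose A j := [set y | V (psi y - a j)].
have mA j : measurable (A j : set (borel Y)).
  apply: (psi_meas (B := [set g | V (g - a j)])); apply: sub_sigma_algebra.
  by apply: open_comp => // x _; exact: translate_continuous.
have mD j : measurable (seqDU A j : set (borel Y)).
  by apply: measurableD => //; apply: bigsetU_measurable => i _.
(* Dividing by [p.+1] keeps the sum of the [p] errors strictly below [d], also for [p = 0]. *)
have dp0 : 0 < d / p.+1%:R by rewrite divr_gt0.
have [K KP] := choice (fun j => borel_inner_regular nu (mD j) dp0).
have cK j : closed (K j) by case: (KP j).
have KD j : K j `<=` seqDU A j by case: (KP j).
have tK : trivIset setT K.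
  move=> i j _ _ [y [Ki Kj]]; apply: (@trivIset_seqDU _ A) => //.
  by exists y; split; exact: KD.
have [eta [ceta eta01 etaK]] := closed_partition_bump p cK tK.
(* On [K j] the value [a j] replaces [psi y] up to [V], and [a i] replaces the constant [g] up to
   [V]. *)
pose theta i y := \sum_(j < p) eta j y * f (y, a j + a i).
exists (\bigcup_(j in `I_p) K j), theta; split.
- exact: closed_bigcup.
(* The translates of [V] cover [G], so each [y] lies in [seqDU A i] for the first index [i] with
   [A i y]. *)
- have sub : ~` (\bigcup_(j in `I_p) K j) `<=`
      \bigcup_(j in `I_p) (seqDU A j `\` K j).
    move=> y nKy.
    have [i0 i0p Ai0] := aP (psi y).
    have ex : exists i, `[< (i < p)%N /\ A i y >] by exists i0; apply/asboolP.
    case: (ex_minnP ex) => i /asboolP[ip Aiy] imin.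
    exists i => //; split; last by move=> Kiy; apply: nKy; exists i.
    split => //; rewrite -(bigcup_mkord _ A) => -[k /= ki Ak].
    have /imin : `[< (k < p)%N /\ A k y >].
      by apply/asboolP; split => //; exact: ltn_trans ip.
    by rewrite leqNgt ki.
  have mDK j : measurable (seqDU A j `\` K j : set (borel Y)).
    by apply: measurableD => //; exact: closed_borel.
  apply: (@le_lt_trans _ _ (\sum_(j < p) nu (seqDU A j `\` K j))).
    apply: (le_trans _ (Boole_inequality nu (n := p) (fun j _ => mDK j))).
    rewrite -(bigcup_mkord _ (fun j => seqDU A j `\` K j)).
    apply: le_measure => //; rewrite inE; last exact: fin_bigcup_measurable.
    by apply: measurableC; apply: closed_borel; exact: closed_bigcup.
  apply: (@le_lt_trans _ _ (\sum_(j < p) (d / p.+1%:R)%:E)).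
    by apply: lee_sum => j _; case: (KP j) => _ _ /ltW.
  rewrite sumEFin lte_fin sumr_const card_ord -[ltLHS]mulr_natr mulrAC.
  by rewrite ltr_pdivrMr// ltr_pM2l// ltr_nat.
- move=> i y; apply: cvg_big => [|j _]; first exact: add_continuous.
  apply: cvgM; first exact: ceta.
  apply: (@continuous_comp _ _ _ (fun y => (y, a j + a i)) f); last exact: f_cont.
  by apply: cvg_pair; [exact: cvg_id|exact: cvg_cst].
- move=> i y; apply: (@le_trans _ _ (\sum_(j < p) M)); last first.
    by rewrite sumr_const card_ord mulr_natl lerDl.
  apply: le_trans (ler_norm_sum _ _ _) _; apply: ler_sum => j _.
  have /andP[e0 e1] := eta01 j y.
  by rewrite normrM (ger0_norm e0) -[M]mul1r ler_pM.
- move=> g; have [i ip Vi] := aP g; exists i => // y [j /= jp Kjy].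
  have -> : theta i y = f (y, a j + a i).
    rewrite /theta (bigD1 (Ordinal jp))//= big1 ?addr0.
      by rewrite (etaK j j)// eqxx mul1r.
    by move=> k kj; rewrite (etaK k j)// (negbTE (_ : k != j :> nat))// mul0r.
  have [Aj _] := KD _ _ Kjy.
  (* Two translations by elements of [V], one replacing [g] and one replacing [psi y], cost [e]
     each. *)
  have := fV y (a j + g) _ Aj; have := fV y (a j + a i) _ Vi.
  have -> : a j + a i + (g - a i) = a j + g.
    by rewrite -addrA [a i + _]addrC subrK.
  have -> : a j + g + (psi y - a j) = psi y + g.
    by rewrite addrC [a j + g]addrC -addrA [- a j + _]addrC addrK.
  rewrite distrC => h1 h2; rewrite distrC.
  apply: le_lt_trans (ler_distD (f (y, a j + g)) _ _) _.
  by rewrite (distrC (f (y, a j + g))) mulrDl mul1r ltrD// distrC.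
Qed.

End transfer_approximation.

(** * Windows of the skew product *)

Section skew_product_windows.
Variables (R : realType) (Y : pointedMetricType R) (S : Y -> Y).
Variables (nu : probability (borel Y) R) (G : topologicalZmodType).
Variables (phi psi : Y -> G).
Hypotheses (Y_compact : compact [set: Y]) (S_cont : continuous S).
Hypothesis nu_inv : invariant_measure S nu.
Hypotheses (G_compact : compact [set: G]) (phi_cont : continuous phi).
Hypothesis phi_coboundary : {ae nu, forall y : Y, phi y = psi (S y) - psi y}.

Let T := @skew_product Y G S phi.

Lemma iter_skew_product_fst n p : (iter n T p).1 = iter n S p.1.
Proof. by elim: n => //= n ->. Qed.

Lemma continuous_iter (X : topologicalType) (h : X -> X) n :
  continuous h -> continuous (iter n h).
Proof.
move=> ch; elim: n => [|n IH] x; first exact: cvg_id.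
by apply: (@continuous_comp _ _ _ (iter n h) h); [exact: IH|exact: ch].
Qed.

Lemma continuous_skew_product : continuous T.
Proof.
move=> p; apply: cvg_pair.
  by apply: (@continuous_comp _ _ _ fst S); [exact: cvg_fst|exact: S_cont].
apply: (@continuous_comp _ _ _ (fun p => (phi p.1, p.2))
  (fun x : G * G => x.1 + x.2)); last exact: add_continuous.
apply: cvg_pair; last exact: cvg_snd.
by apply: (@continuous_comp _ _ _ fst phi); [exact: cvg_fst|exact: phi_cont].
Qed.

Definition coboundary_orbit : set Y :=
  [set z | forall n, phi (iter n S z) = psi (iter n.+1 S z) - psi (iter n S z)].

Lemma iter_skew_product_coboundary z g n : coboundary_orbit z ->
  iter n T (z, g) = (iter n S z, psi (iter n S z) + (g - psi z)).
Proof.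
move=> cz; elim: n => [|n IH]; first by rewrite /= addrCA subrr addr0.
by rewrite iterS IH /T /skew_product/= cz addrA subrK.
Qed.

Lemma iter_preimage_borel (A : set (borel Y)) n : measurable A ->
  measurable (iter n S @^-1` A : set (borel Y)) /\
  nu (iter n S @^-1` A) = nu A.
Proof.
move=> mA; elim: n => [//|n [mn IH]].
have -> : iter n.+1 S @^-1` A = S @^-1` (iter n S @^-1` A).
  by apply/seteqP; split => z /=; rewrite -iterSr.
split; last by rewrite nu_inv.
rewrite -[X in measurable X]setTI.
by apply: continuous_borel_measurable_fun.
Qed.

(** The exceptional points lie in the union of the preimages of one null set under the iterates of
    [S], each null by invariance. *)
Lemma coboundary_orbit_ae : exists N : set (borel Y),
  [/\ measurable N, nu N = 0%E & ~` coboundary_orbit `<=` N].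
Proof.
have [N0 [mN0 N00 sub]] := phi_coboundary.
exists (\bigcup_n (iter n S @^-1` N0)); split.
- by apply: bigcupT_measurable => n; case: (iter_preimage_borel n mN0).
- apply/eqP; rewrite -measure_le0.
  apply: le_trans (generalized_Boole_inequality nu _ _) _.
  + by move=> n; case: (iter_preimage_borel n mN0).
  + by apply: bigcupT_measurable => n; case: (iter_preimage_borel n mN0).
  + rewrite eseries0// => n _ _.
    by have [_ nuN] := iter_preimage_borel n mN0; exact: etrans nuN N00.
- move=> z /existsNP[n nz]; exists n => //; apply: sub => /=; exact: nz.
Qed.

(** Markov's inequality for the number of visits to [A] before time [L], whose integral is
    [L%:R * nu A] by invariance. *)
Lemma visits_markov (A : set (borel Y)) (L : nat) (c : R) :
  measurable A -> 0 < c ->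
  measurable ([set z | c <= \sum_(n < L) (\1_A (iter n S z) : R)]
    : set (borel Y)) /\
  (c%:E * nu [set z | (c <= \sum_(n < L) (\1_A (iter n S z) : R))%R]
     <= L%:R%:E * nu A)%E.
Proof.
move=> mA c0; set E := [set z | _].
pose A' (n : nat) : set (borel Y) := iter n S @^-1` A.
have mA' n : measurable (A' n) by case: (iter_preimage_borel n mA).
pose h (z : borel Y) : R := \sum_(n < L) (\1_(A' n) z : R).
have mh : measurable_fun [set: borel Y] h.
  by apply: measurable_sum => n; exact: measurable_indic.
have mE : measurable (E : set (borel Y)).
  have -> : E = [set: borel Y] `&` h @^-1` `[c, +oo[.
    rewrite setTI; apply/seteqP; split => z; rewrite /E /h /= in_itv/= andbT.
      by under eq_bigr do rewrite indicE.
    by under eq_bigr do rewrite indicE.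
  by apply: mh.
split => //.
have -> : (c%:E * nu E)%E = (\int[nu]_z ((c * \1_E z)%:E))%E.
  under eq_integral do rewrite EFinM.
  rewrite ge0_integralZl//.
  - by rewrite integral_indic// setIT.
  - by apply/measurable_EFinP; exact: measurable_indic.
  - exact: ltW.
have -> : (L%:R%:E * nu A)%E = (\int[nu]_z (\sum_(n < L) (\1_(A' n) z)%:E))%E.
  rewrite ge0_integral_sum//; last first.
    by move=> n; apply/measurable_EFinP; exact: measurable_indic.
  rewrite (eq_bigr (fun=> nu A)); last first.
    move=> n _; rewrite integral_indic// setIT.
    exact: (iter_preimage_borel n mA).2.
  rewrite -[nu A]fineK ?fin_num_measure// sumEFin sumr_const card_ord.
  by rewrite -EFinM mulr_natl.
apply: ge0_le_integral => //.
- by move=> z _; rewrite lee_fin mulr_ge0// ltW.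
- apply/measurable_EFinP; apply: measurable_funM => //; exact: measurable_indic.
- by under eq_fun do rewrite sumEFin; apply/measurable_EFinP.
- move=> z _; rewrite sumEFin lee_fin indicE.
  have [zE|] := boolP (z \in E); last by rewrite mulr0 sumr_ge0.
  by rewrite mulr1; move: zE; rewrite inE /E /=.
Qed.

Variables (f : Y * G -> R) (M B e d : R) (p : nat).
Variables (K : set Y) (theta : nat -> Y -> R).
Hypotheses (f_cont : continuous f) (f_bounded : forall q, `|f q| <= M).
Hypotheses (theta_cont : forall i, continuous (theta i)).
Hypotheses (theta_bounded : forall i y, `|theta i y| <= B).
Hypotheses (M_gt0 : 0 < M) (B_gt0 : 0 < B) (e_gt0 : 0 < e).
Hypotheses (K_closed : closed K) (nuK : (nu (~` K) < d%:E)%E).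
Hypothesis theta_close : forall g, exists2 i, (i < p)%N &
  forall y, K y -> `|f (y, psi y + g) - theta i y| < 2 * e.

(** Quantifying over [g] makes badness depend on the base point only. The merely measurable [psi]
    does not occur, so the set can be closed. The threshold [3 * e] exceeds the error [2 * e] on [K]
    by a margin for the visits outside [K]. *)
Definition bad_window (L : nat) : set Y :=
  [set z | exists g : G, forall i, (i < p)%N ->
    3 * e * L%:R <= \sum_(n < L) `|f (iter n T (z, g)) - theta i (iter n S z)|].

(** It is the projection to [Y] of a closed subset of the compact space [Y * G]. *)
Lemma bad_window_closed L : closed (bad_window L).
Proof.
pose W i (q : Y * G) := \sum_(n < L) `|f (iter n T q) - theta i (iter n S q.1)|.
have cW i : continuous (W i).
  move=> q; apply: cvg_big => [|n _]; first exact: add_continuous.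
  apply: cvg_norm; apply: cvgB.
    apply: (@continuous_comp _ _ _ (iter n T) f); last exact: f_cont.
    exact: continuous_iter continuous_skew_product _.
  apply: (@continuous_comp _ _ _ fst (fun y => theta i (iter n S y))).
    exact: cvg_fst.
  apply: (@continuous_comp _ _ _ (iter n S) (theta i)); last exact: theta_cont.
  exact: continuous_iter.
pose Q := \bigcap_(i in `I_p) (W i @^-1` [set x | 3 * e * L%:R <= x]).
have cQ : closed Q.
  apply: closed_bigI => i _; apply: closed_comp; last exact: closed_ge.
  by move=> q _; exact: cW.
have -> : bad_window L = fst @` Q.
  apply/seteqP; split => [z [g zg]|_ [[z g] Qz <-]].
    by exists (z, g) => // i ip; exact: zg.
  by exists g => i ip; exact: Qz.
apply: compact_closed; first exact: metric_hausdorff.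
apply: continuous_compact.
  by apply: continuous_subspaceT => q; exact: cvg_fst.
apply: (subclosed_compact cQ (_ : compact [set: Y * G])) => //.
by rewrite -setXTT; exact: compact_setX.
Qed.

(** For almost every [z], the index [i] attached to [g - psi z] makes a visit to [K] cost at most
    [2 * e] and any other visit at most [2 * e + (M + B)]. A bad window thus makes at least
    [e * L%:R / (M + B)] visits outside [K], which Markov's inequality bounds independently of
    [L]. *)
Lemma bad_window_small L : (0 < L)%N ->
  (nu (bad_window L) <= ((M + B) / e * d)%:E)%E.
Proof.
move=> L0.
have MB0 : 0 < M + B by rewrite addr_gt0.
pose c := e * L%:R / (M + B).
have c0 : 0 < c by rewrite divr_gt0// mulr_gt0// ltr0n.
have mK : measurable (~` K : set (borel Y)).
  by apply: measurableC; exact: closed_borel.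
have [mE leE] := visits_markov L mK c0.
set E := [set z | _] in mE leE.
have [N [mN N0 cobN]] := coboundary_orbit_ae.
have sub : bad_window L `<=` E `|` N.
  move=> z [g zg]; have [cz|ncz] := pselect (coboundary_orbit z); last first.
    by right; exact: cobN.
  left; rewrite /E /= /c ler_pdivrMr//.
  have [i ip close] := theta_close (g - psi z).
  have sum_le : \sum_(n < L) `|f (iter n T (z, g)) - theta i (iter n S z)| <=
      \sum_(n < L) (2 * e + (M + B) * \1_(~` K) (iter n S z)).
    apply: ler_sum => n _; rewrite iter_skew_product_coboundary// indicE.
    have [zK|] := boolP (iter n S z \in ~` K).
      rewrite mulr1 -[leLHS]add0r lerD//; first by rewrite mulr_ge0// ltW.
      by rewrite (le_trans (ler_normB _ _))// lerD.
    by rewrite mulr0 addr0 notin_setE /= => /contrapT /close/ltW.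
  have := le_trans (zg i ip) sum_le.
  rewrite big_split/= sumr_const card_ord -mulr_sumr -[2 * e *+ L]mulr_natr.
  lra.
have ED : (nu E <= ((M + B) / e * d)%:E)%E.
  rewrite -[nu E]fineK ?fin_num_measure// lee_fin.
  move: leE nuK; rewrite -[nu E]fineK ?fin_num_measure//.
  rewrite -[nu (~` K)]fineK ?fin_num_measure// -!EFinM lee_fin lte_fin => leE lt.
  have L0' : 0 < L%:R :> R by rewrite ltr0n.
  have le2 : c * fine (nu E) <= L%:R * d.
    by apply: le_trans leE _; rewrite ler_wpM2l// ltW.
  have -> : (M + B) / e * d = L%:R * d / c.
    by rewrite /c; field; rewrite !lt0r_neq0.
  by rewrite ler_pdivlMr// mulrC.
apply: (@le_trans _ _ (nu (E `|` N))).
  apply: le_measure; rewrite ?inE//; last exact: measurableU.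
  by apply: closed_borel; exact: bad_window_closed.
apply: le_trans (measureU2 nu mE mN) _.
by rewrite -[leRHS]adde0; apply: (leeD ED); rewrite le_eqVlt; apply/orP; left;
  exact/eqP.
Qed.

End skew_product_windows.

(** * The complex modulus and sums cut into windows *)

Section complex_modulus.
Variable R : realType.
Implicit Types z : R[i].
Import Normc.

Lemma normc_ge0 z : 0 <= normc z.
Proof. by case: z => a b; exact: sqrtr_ge0. Qed.

Lemma normc_real (x : R) : normc x%:C = `|x|.
Proof. by rewrite /normc/= expr0n/= addr0 sqrtr_sqr. Qed.

Lemma normc_sum (I : Type) (s : seq I) (Q : pred I) (F : I -> R[i]) :
  normc (\sum_(i <- s | Q i) F i) <= \sum_(i <- s | Q i) normc (F i).
Proof.
apply: (big_ind2 (fun x y => normc x <= y)) => //; first by rewrite normc0.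
by move=> x1 y1 x2 y2 xy1 xy2; apply: le_trans (le_normcD _ _) (lerD xy1 xy2).
Qed.

Lemma cvgc0P (a : nat -> R[i]) :
  a n @[n --> \oo] --> (0 : R[i]) <-> normc (a n) @[n --> \oo] --> (0 : R).
Proof.
split => [/cvgr0Pnorm_lt H|/cvgr0Pnorm_lt H]; apply/cvgr0Pnorm_lt => e e0.
  have e0' : 0 < e%:C by rewrite ltcR.
  apply: filterS (H _ e0') => n.
  by rewrite (ger0_norm (normc_ge0 _)) -ltcR.
(* A positive element of [R[i]] has imaginary part 0, so [e] is a real radius. *)
case: e e0 => e e'; rewrite ltcE/= => /andP[/eqP-> e0].
apply: filterS (H _ e0) => n; rewrite (ger0_norm (normc_ge0 _)) => lt.
by rewrite -[ltLHS]/((normc (a n))%:C) complexr0 ltcR.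
Qed.

Lemma continuous_real_complex (X : topologicalType) (g : X -> R) :
  continuous g -> continuous (fun x => (g x)%:C : R[i]).
Proof.
move=> cg x; apply/cvgrPdist_lt => e e0.
case: e e0 => e e'; rewrite ltcE/= => /andP[/eqP-> e0].
have /cvgrPdist_lt/(_ _ e0) := cg x; apply: filterS => y lt.
by rewrite -rmorphB -[ltLHS]/((normc (g x - g y)%:C)%:C) normc_real complexr0
  ltcR.
Qed.

Lemma normc_ge_part z : `|complex.Re z| <= normc z /\ `|complex.Im z| <= normc z.
Proof.
case: z => a b /=; split; rewrite -[leLHS]sqrtr_sqr ler_sqrt ?addr_ge0 ?sqr_ge0//.
  by rewrite lerDl sqr_ge0.
by rewrite lerDr sqr_ge0.
Qed.

Lemma continuous_Re_Im (X : topologicalType) (g : X -> R[i]) :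
  continuous g -> continuous (fun x => complex.Re (g x)) /\
  continuous (fun x => complex.Im (g x)).
Proof.
move=> cg; split=> x; apply/cvgrPdist_lt => e e0;
  have /cvgrPdist_lt/(_ e%:C) := cg x; rewrite ltcR => /(_ e0);
  apply: filterS => y; rewrite -[X in X < _ -> _]/((normc (g x - g y))%:C) ltcR;
  apply: le_lt_trans; rewrite -raddfB; by case: (normc_ge_part (g x - g y)).
Qed.

(** What the windows leave out is a head of length [r] and a tail shorter than [L], each
    contributing at most [L%:R * D]. *)
Lemma windows_bound (h : nat -> R[i]) (N L r : nat) (D : R) (w : nat -> R) :
  (r < L)%N -> (r <= N)%N -> 0 <= D -> (forall n, normc (h n) <= D) ->
  (forall k, (k < (N - r) %/ L)%N ->
    normc (\sum_(r + k * L <= n < r + k.+1 * L) h n) <= w k) ->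
  normc (\sum_(n < N) h n) <= 2 * L%:R * D + \sum_(k < (N - r) %/ L) w k.
Proof.
move=> rL rN D0 hD hw; set m := ((N - r) %/ L)%N in hw *.
have dvE := divn_eq (N - r) L; have L0 : (0 < L)%N by exact: leq_ltn_trans rL.
have := ltn_pmod (N - r) L0 => md.
have mid : \sum_(r <= n < r + m * L) h n =
    \sum_(k < m) \sum_(r + k * L <= n < r + k.+1 * L) h n.
  elim: (m) => [|k IH]; first by rewrite mul0n addn0 big_geq// big_ord0.
  rewrite big_ord_recr/= -IH -big_cat_nat//; first by rewrite leq_addr.
  by rewrite leq_add2l leq_mul2r leqnSn orbT.
have edge s t : (t <= s + L)%N -> normc (\sum_(s <= n < t) h n) <= L%:R * D.
  move=> tsL; apply: le_trans (normc_sum _ _ _) _.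
  apply: (@le_trans _ _ (\sum_(s <= n < t) D)); first exact: ler_sum.
  rewrite sumr_const_nat -[leLHS]mulr_natl ler_wpM2r// ler_nat; lia.
rewrite -(big_mkord xpredT h) (@big_cat_nat _ _ _ r 0 N)//=.
rewrite (@big_cat_nat _ _ _ (r + m * L) r N)//=; [|exact: leq_addr|rewrite /m; lia].
rewrite mid; apply: le_trans (le_normcD _ _) _.
have h1 : normc (\sum_(0 <= n < r) h n) <= L%:R * D by apply: edge; lia.
have h3 : normc (\sum_(r + m * L <= n < N) h n) <= L%:R * D.
  by apply: edge; rewrite /m; lia.
have h2 : normc (\sum_(k < m) \sum_(r + k * L <= n < r + k.+1 * L) h n) <=
    \sum_(k < m) w k.
  by apply: le_trans (normc_sum _ _ _) _; apply: ler_sum => k _; exact: hw.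
have := le_normcD (\sum_(k < m) \sum_(r + k * L <= n < r + k.+1 * L) h n)
  (\sum_(r + m * L <= n < N) h n).
lra.
Qed.

(** The [L] residue classes sample disjoint sets of times below [N], so the smallest of the [L] sums
    is at most their average. *)
Lemma residue_class_average (g : nat -> R) (N L : nat) :
  (0 < L)%N -> (forall n, 0 <= g n) ->
  exists2 r, (r < L)%N &
    L%:R * \sum_(k < (N - r) %/ L) g (r + k * L)%N <= \sum_(n < N) g n.
Proof.
move=> L0 g0; apply: contrapT => H.
have lt (r : 'I_L) :
    \sum_(n < N) g n < L%:R * \sum_(k < (N - r) %/ L) g (r + k * L)%N.
  by rewrite ltNge; apply/negP => le; apply: H; exists r.
(* Extension by 0 gives all classes the same number [N] of terms, so that the double sum can be
   exchanged. *)
pose g' n := if (n < N)%N then g n else 0.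
have g'0 n : 0 <= g' n by rewrite /g'; case: ifP.
have total : \sum_(r < L) \sum_(k < (N - r) %/ L) g (r + k * L)%N <=
    \sum_(n < N) g n.
  apply: (@le_trans _ _ (\sum_(r < L) \sum_(k < N) g' (r + k * L)%N)).
    apply: ler_sum => r _.
    have le_N : ((N - r) %/ L <= N)%N.
      by apply: leq_trans (leq_div _ _) _; exact: leq_subr.
    rewrite -(big_mkord xpredT (fun k => g (r + k * L)%N)).
    rewrite -(big_mkord xpredT (fun k => g' (r + k * L)%N)).
    rewrite (@big_cat_nat _ _ _ ((N - r) %/ L) 0 N)//=.
    rewrite -[leLHS]addr0 lerD ?sumr_ge0//.
    rewrite big_nat [leRHS]big_nat; apply: ler_sum => k /= kN.
    rewrite /g' ifT//.
    have := leq_trunc_div (N - r) L.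
    have : (k.+1 * L <= (N - r) %/ L * L)%N by rewrite leq_mul2r kN orbT.
    by rewrite mulSn; lia.
  rewrite exchange_big/=.
  have -> : \sum_(k < N) \sum_(r < L) g' (r + k * L)%N =
      \sum_(0 <= n < N * L) g' n.
    rewrite big_nat_mul.
    rewrite -(big_mkord xpredT (fun k => \sum_(r < L) g' (r + k * L)%N)).
    apply: eq_bigr => k _.
    rewrite -[X in \big[_/_]_(X <= _ < _) _]add0n big_addn mulSn addnK.
    by rewrite big_mkord.
  have NL : (N <= N * L)%N by rewrite leq_pmulr.
  have tail0 : \sum_(N <= n < N * L) g' n = 0.
    rewrite big_nat_cond big1// => n /andP[/andP[Nn _] _].
    by rewrite /g' ltnNge Nn.
  rewrite (@big_cat_nat _ _ _ N 0 (N * L))//= tail0 addr0 big_mkord.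
  by apply: ler_sum => n _; rewrite /g' ltn_ord.
suff : \sum_(r < L) (\sum_(n < N) g n) <
    \sum_(r < L) L%:R * \sum_(k < (N - r) %/ L) g (r + k * L)%N.
  rewrite -mulr_sumr sumr_const card_ord -[ltLHS]mulr_natl ltr_pM2l ?ltr0n//.
  by rewrite ltNge total.
by apply: ltr_sum => //; apply/hasP; exists (Ordinal L0); rewrite ?mem_index_enum.
Qed.

End complex_modulus.

(** * Real-valued observables *)

Section real_observable.
Variables (R : realType) (u : nat -> R[i]).
Hypothesis u_bounded : bounded_sequence u.
Variables (Y : pointedMetricType R) (S : Y -> Y).
Hypothesis Y_tds : topological_dynamical_system S.
Import Normc.

Lemma strong_MOMO_orbit_average (y : Y) (theta : Y -> R) (b : nat -> nat) :
  strong_MOMO S u -> continuous theta -> block_sequence b ->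
  ((b K)%:R^-1 * \sum_(k < K)
      normc (\sum_(b k <= n < b k.+1) (theta (iter n S y))%:C * u n))
    @[K --> \oo] --> (0 : R).
Proof.
move=> momo ctheta hb.
have /cvgc0P := momo b (fun k => iter (b k) S y) (fun z => (theta z)%:C) hb
  (continuous_real_complex ctheta).
rewrite (eq_cvg _ _ (g := fun K => (b K)%:R^-1 * \sum_(k < K)
  normc (\sum_(b k <= n < b k.+1) (theta (iter n S y))%:C * u n)))//= => K.
rewrite -[RHS]ger0_norm; last first.
  by rewrite mulr_ge0 ?invr_ge0// sumr_ge0// => k _; exact: normc_ge0.
rewrite -normc_real; congr (normc _).
rewrite rmorphM fmorphV rmorph_nat rmorph_sum; congr (_ * _).
apply: eq_bigr => k _; rewrite -[LHS]/((normc _)%:C); congr (normc _)%:C.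
apply: eq_big_nat => n /andP[bn _].
by rewrite -iterD subnK.
Qed.

Variable nu : probability (borel Y) R.
Hypotheses (S_ue : uniquely_ergodic S nu) (S_momo : strong_MOMO S u).
Variable G : topologicalZmodType.
Hypothesis G_compact : compact [set: G].
Variables (phi psi : Y -> G).
Hypotheses (phi_cont : continuous phi) (psi_meas : borel_measurable psi).
Hypothesis phi_coboundary : {ae nu, forall y : Y, phi y = psi (S y) - psi y}.

Let T := @skew_product Y G S phi.

(** Four errors of [eps / 4 * N%:R] add up: the ends outside the windows, the sums of the [theta i]
    over windows, the approximation error on good windows, and the trivial bound on bad windows. *)
Lemma real_observable_sum_small (f : Y * G -> R) (q : Y * G) (eps : R) :
  continuous f -> 0 < eps ->
  \forall N \near \oo,
    normc (\sum_(n < N) (f (iter n T q))%:C * u n) <= eps * N%:R.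
Proof.
move=> cf eps0; have [cY cS] := Y_tds; have nu_inv := S_ue.1.
have [U0 U0P] := u_bounded.
pose U := `|U0| + 1.
have Ugt0 : 0 < U by rewrite ltr_wpDl.
have uU n : normc (u n) <= U.
  rewrite (@le_trans _ _ U0)//; first by rewrite -lecR; exact: U0P.
  by rewrite (le_trans (ler_norm _))// lerDl.
have cYG : compact [set: Y * G] by rewrite -setXTT; exact: compact_setX.
have [M M0 fM] := compact_real_bounded cYG cf.
(* A good window of length [L] has error at most [3 * e * L%:R * U], that is [eps / 4] per unit of
   time. *)
pose e := eps / 4 / (3 * U).
have e0 : 0 < e by rewrite !divr_gt0// mulr_gt0.
have [p [B [B0 approx]]] := transfer_approximation nu cY G_compact psi_meas cf e0.
(* Visits to [Bad] have frequency at most [2 * kappa], once for its measure and once for the slack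
   in the frequency bound; times [M * U] this is [eps / 4]. *)
pose kappa := eps / 8 / (M * U).
have kappa0 : 0 < kappa by rewrite !divr_gt0// mulr_gt0.
(* This choice turns the bound on the measure of the bad windows into [kappa]. It is possible
   because [B] was fixed before [d]. *)
pose d := kappa / ((M + B) / e).
have MB0 : 0 < M + B by rewrite addr_gt0.
have d0 : 0 < d by rewrite divr_gt0// divr_gt0.
have [K [theta [cK nuK ctheta thetaB thetaf]]] := approx d d0.
(* Summing over all [i] gives one cost, hence one [L], that serves whichever [theta i] a window
   selects. *)
pose c s t := \sum_(i < p)
  normc (\sum_(s <= n < t) (theta i (iter n S q.1))%:C * u n).
have c_ge0 s t : 0 <= c s t by apply: sumr_ge0 => i _; exact: normc_ge0.
have eps4 : 0 < eps / 4 by rewrite divr_gt0.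
have [b hb|L L0 HL] := block_average_windows c_ge0 eps4.
  have -> : (fun K => (b K)%:R^-1 * \sum_(k < K) c (b k) (b k.+1)) =
      (fun K => \sum_(i < p) ((b K)%:R^-1 * \sum_(k < K)
        normc (\sum_(b k <= n < b k.+1) (theta i (iter n S q.1))%:C * u n))).
    apply/funext => k; rewrite -mulr_sumr; congr (_ * _).
    by rewrite exchange_big.
  have : \sum_(i < p) ((b K)%:R^-1 * \sum_(k < K)
      normc (\sum_(b k <= n < b k.+1) (theta i (iter n S q.1))%:C * u n))
      @[K --> \oo] --> \sum_(i < p) (0 : R).
    apply: cvg_big => [|i _]; first exact: add_continuous.
    exact: strong_MOMO_orbit_average.
  by rewrite big1.
pose Bad := bad_window S phi f e p theta L.
have cBad : closed Bad by exact: bad_window_closed.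
have nuBad : fine (nu Bad) <= kappa.
  have := bad_window_small cY cS nu_inv G_compact phi_cont phi_coboundary cf fM
    ctheta thetaB M0 B0 e0 cK nuK thetaf L0.
  rewrite -/Bad -[nu Bad]fineK ?fin_num_measure ?lee_fin//; last exact: closed_borel.
  by rewrite /d mulrCA mulfV ?mulr1// lt0r_neq0// divr_gt0.
have visits := closed_visits_le q.1 Y_tds S_ue cBad kappa0.
have window z g : exists2 i, (i < p)%N & z \notin Bad ->
    \sum_(n < L) `|f (iter n T (z, g)) - theta i (iter n S z)| <= 3 * e * L%:R.
  (* This only supplies an index below [p] for the case where [z] is in [Bad]. *)
  have [i0 ip _] := thetaf 0.
  have [zB|zB] := boolP (z \in Bad); first by exists i0.
  apply: contrapT => H; move: zB; rewrite notin_setE; apply.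
  exists g => i ip'; rewrite leNgt; apply/negP => /ltW lt; apply: H.
  by exists i.
pose D := M * U.
have D0 : 0 < D by rewrite mulr_gt0.
have hD n : normc ((f (iter n T q))%:C * u n) <= D.
  by rewrite normcM normc_real ler_pM// normc_ge0.
have large : \forall N \near \oo, 2 * L%:R * D <= eps / 4 * N%:R.
  exists (Num.truncn (2 * L%:R * D / (eps / 4))).+1 => // N /= NN.
  rewrite -ler_pdivrMl// mulrC.
  by rewrite (le_trans (ltW (truncnS_gt _)))// ler_nat.
have L_le : \forall N \near \oo, (L <= N)%N by exists L.
apply: filterS (filterI (filterI visits HL) (filterI large L_le)) => N.
move=> [[visits_le cost_le] [large_le LN]].
(* Windows must start in one residue class mod [L], so pick a class visiting [Bad]
   no more often than the average. *)
have [r rL rAvg] : exists2 r, (r < L)%N & L%:R * \sum_(k < (N - r) %/ L)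
    \1_Bad (iter (r + k * L) S q.1) <= \sum_(n < N) (\1_Bad (iter n S q.1) : R).
  exact: (@residue_class_average R (fun n => \1_Bad (iter n S q.1))).
have rN : (r <= N)%N by exact: leq_trans (ltnW rL) LN.
have {}cost_le := cost_le r rL.
pose w k := c (r + k * L)%N (r + k.+1 * L)%N +
  (3 * e * L%:R * U + L%:R * D * \1_Bad (iter (r + k * L) S q.1)).
have win k : (k < (N - r) %/ L)%N -> normc (\sum_(r + k * L <= n < r + k.+1 * L)
    (f (iter n T q))%:C * u n) <= w k.
  move=> _; set s := (r + k * L)%N.
  have tE : (r + k.+1 * L = L + s)%N by rewrite mulSn addnCA.
  have reindex (F : nat -> R) :
      \sum_(s <= n < L + s) F n = \sum_(n < L) F (n + s)%N.
    by rewrite -[X in \big[_/_]_(X <= _ < _) _]add0n big_addn addnK big_mkord.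
  rewrite /w indicE -/s tE.
  have [i ip close] := window (iter s S q.1) (iter s T q).2.
  have [zB|zB] := boolP (iter s S q.1 \in Bad).
    apply: le_trans (normc_sum _ _ _) _.
    rewrite reindex mulr1.
    have sum_le : \sum_(n < L) normc ((f (iter (n + s) T q))%:C * u (n + s)%N) <=
        L%:R * D.
      apply: (@le_trans _ _ (\sum_(n < L) D)); first exact: ler_sum.
      by rewrite sumr_const card_ord mulr_natl.
    have := c_ge0 s (L + s)%N.
    have : 0 <= 3 * e * L%:R * U.
      by apply: mulr_ge0 (ltW Ugt0); apply: mulr_ge0 => //; apply: mulr_ge0 (ltW e0).
    lra.
  rewrite mulr0 addr0.
  have -> : \sum_(s <= n < L + s) (f (iter n T q))%:C * u n =
      \sum_(s <= n < L + s) (theta i (iter n S q.1))%:C * u n +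
      \sum_(s <= n < L + s) (f (iter n T q) - theta i (iter n S q.1))%:C * u n.
    rewrite -big_split/=; apply: eq_bigr => n _.
    by rewrite -mulrDl -rmorphD/= addrC subrK.
  apply: le_trans (le_normcD _ _) _; apply: lerD.
    rewrite /c (bigD1 (Ordinal ip))//= lerDl sumr_ge0// => i' _.
    exact: normc_ge0.
  apply: le_trans (normc_sum _ _ _) _; rewrite reindex.
  have {}close := close zB.
  apply: (@le_trans _ _ ((\sum_(n < L)
      `|f (iter n T (iter s S q.1, (iter s T q).2)) -
        theta i (iter n S (iter s S q.1))|) * U)); last by rewrite ler_wpM2r// ltW.
  rewrite mulr_suml; apply: ler_sum => n _.
  rewrite normcM normc_real -(iter_skew_product_fst S phi s q) -surjective_pairing.
  by rewrite (iter_skew_product_fst S phi s q) -!iterD ler_wpM2l.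
apply: le_trans (windows_bound rL rN (ltW D0) hD win) _.
rewrite /w big_split/= big_split/= sumr_const card_ord -mulr_sumr.
have m_le : ((N - r) %/ L)%:R * L%:R <= N%:R :> R.
  rewrite -natrM ler_nat (leq_trans (leq_trunc_div _ _))//; exact: leq_subr.
have good_le : 3 * e * L%:R * U *+ ((N - r) %/ L) <= eps / 4 * N%:R.
  rewrite -mulr_natl.
  have -> : ((N - r) %/ L)%:R * (3 * e * L%:R * U) =
      eps / 4 * (((N - r) %/ L)%:R * L%:R).
    by rewrite /e; field; rewrite lt0r_neq0.
  by rewrite ler_pM2l.
have bad_le : L%:R * D *
    \sum_(k < (N - r) %/ L) (\1_Bad (iter (r + k * L) S q.1) : R) <=
    eps / 4 * N%:R.
  rewrite mulrAC.
  apply: (@le_trans _ _ ((fine (nu Bad) + kappa) * N%:R * D)).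
    by rewrite ler_wpM2r ?(ltW D0)// (le_trans rAvg).
  apply: (@le_trans _ _ ((kappa + kappa) * N%:R * D)).
    by rewrite ler_wpM2r ?(ltW D0)// ler_wpM2r// lerD2r.
  rewrite le_eqVlt; apply/orP; left; apply/eqP.
  by rewrite /kappa /D; field; rewrite !lt0r_neq0.
lra.
Qed.

End real_observable.

(** * Complex observables through their real and imaginary parts *)

Theorem theorem26 (R : realType) (u : nat -> R[i])
  (u_bounded : bounded_sequence u)
  (u_mult : multiplicative_function u)
  (u_short : short_interval_aperiodic u)
  (Y : pointedMetricType R) (S : Y -> Y)
  (Y_tds : topological_dynamical_system S)
  (nu : probability (borel Y) R)
  (S_ue : uniquely_ergodic S nu)
  (S_momo : strong_MOMO S u)
  (G : topologicalZmodType)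
  (G_compact : compact [set: G]) (G_metric : metrizable R G)
  (phi : Y -> G) (phi_cont : continuous phi)
  (psi : Y -> G) (psi_meas : borel_measurable psi)
  (phi_coboundary : {ae nu, forall y : Y, phi y = psi (S y) - psi y}) :
  sarnak_property (@skew_product Y G S phi) u.
Proof.
move=> q f cf; apply/cvgc0P; apply/cvgr0Pnorm_le => eps eps0.
have [cRe cIm] := continuous_Re_Im cf.
have eps2 : 0 < eps / 2 by rewrite divr_gt0.
have small g (cg : continuous g) := real_observable_sum_small u_bounded Y_tds S_ue
  S_momo G_compact phi_cont psi_meas phi_coboundary q cg eps2.
have N0 : \forall N \near \oo, (0 < N)%N by exists 1%N.
move: (small _ cRe) (small _ cIm) N0; apply: filterS3 => N sRe sIm N0.
have normcN : Normc.normc (N%:R : R[i]) = N%:R.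
  by rewrite -(rmorph_nat (real_complex R)) normc_real ger0_norm.
rewrite (ger0_norm (normc_ge0 _)) Normc.normcM Normc.normcV normcN.
rewrite ler_pdivrMl ?ltr0n// mulrC.
have -> : \sum_(n < N) f (iter n (skew_product S phi) q) * u n =
    \sum_(n < N) (complex.Re (f (iter n (skew_product S phi) q)))%:C * u n +
    'i%C * \sum_(n < N) (complex.Im (f (iter n (skew_product S phi) q)))%:C * u n.
  rewrite mulr_sumr -big_split/=; apply: eq_bigr => n _.
  by rewrite mulrA -mulrDl -complexE.
apply: le_trans (le_normcD _ _) _.
have -> : eps * N%:R = eps / 2 * N%:R + eps / 2 * N%:R by field.
apply: lerD sRe _.
by rewrite Normc.normcM {1}/Normc.normc/= expr0n expr1n add0r sqrtr1 mul1r.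
Qed.
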